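(* Let $G$ be a finite group such that the difference subgroup graph $D(G)$ is clawfree. Then $G$ is supersolvable.
   Context: For a finite group $G$, the difference subgroup graph $D(G)$ is the undirected graph whose vertices are the non-trivial proper subgroups of $G$, with two distinct vertices $H$ and $K$ adjacent if and only if $\langle H,K\rangle = G$ and $HK\neq G$, where $HK=\{hk : h\in H,\ k\in K\}$. A graph is clawfree if it has no induced subgraph isomorphic to the claw $K_{1,3}$. *)

(* Defs.v *)
From mathcomp Require Import all_boot all_fingroup all_solvable.
Set Implicit Arguments.
Unset Strict Implicit.
Unset Printing Implicit Defensive.
Import GroupScope.

(* A graph is a symmetric irreflexive adjacency relation, on a finType of vertices. *)
Definition has_induced_subgraph (V W : finType) (e : rel V) (f : rel W) : Prop :=
  exists phi : W -> V,
    injective phi /\ forall x y : W, e (phi x) (phi y) = f x y.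

Definition complete_bipartite (m n : nat) : rel ('I_m + 'I_n) :=
  fun x y => match x, y with
             | inl _, inr _ | inr _, inl _ => true
             | _, _ => false
             end.

Definition clawfree (V : finType) (e : rel V) : Prop :=
  ~ has_induced_subgraph e (@complete_bipartite 1 3).

Definition nontrivial_proper_subgroup (gT : finGroupType) (G : {group gT}) :
    pred {group gT} :=
  fun H => (H :!=: 1) && (H \proper G).

Definition diff_vertex (gT : finGroupType) (G : {group gT}) : finType :=
  {H : {group gT} | nontrivial_proper_subgroup G H}.

Definition diff_graph (gT : finGroupType) (G : {group gT}) :
    rel (diff_vertex G) :=
  fun H K => [&& H != K, val H <*> val K == G & val H * val K != G].

Lemma diff_graph_irreflexive (gT : finGroupType) (G : {group gT}) :
  irreflexive (@diff_graph gT G).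
Proof. by move=> H; rewrite /diff_graph eqxx. Qed.

Lemma diff_graph_symmetric (gT : finGroupType) (G : {group gT}) :
  symmetric (@diff_graph gT G).
Proof.
move=> H K; rewrite /diff_graph eq_sym joingC; congr [&& _, _ & ~~ _].
by rewrite -(inj_eq invg_inj) invMg !invGid.
Qed.

Definition normal_cyclic_factor (gT : finGroupType) (A V U : {set gT}) : bool :=
  [&& V \subset U, V <| A, U <| A & cyclic (U / V)].

(* The series s is 1 = G_0 <= G_1 <= ... <= G_n = G, with every G_i normal
   in G itself (not just in G_(i+1)) and every factor cyclic. *)
Definition supersolvable (gT : finGroupType) (G : {group gT}) : Prop :=
  exists2 s : seq {group gT},
    (normal_cyclic_factor G).-series 1%G s & last 1%G s = G.

(* Main.v *)
(* If all maximal subgroups of G are normal, G is nilpotent and its chief factors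
   are cyclic. Otherwise let M be a non-normal maximal subgroup. For g outside M,
   the product of M and M^g is not G, so every subgroup of M^g not contained in M
   is adjacent to M and, as there is no claw, there are at most two of them; this
   forces M to be cyclic. Then the intersection of M and M^g centralises both,
   hence lies in Z = Z(G), and G/Z is a Frobenius group with complement M/Z. If
   its kernel K were not cyclic, the preimages of three distinct proper
   non-trivial subgroups of K would be the leaves of a claw with centre M. So
   1 <= Z <= (preimage of K) <= G has cyclic factors. *)
Require Import Defs.
From mathcomp Require Import all_boot all_fingroup all_solvable.
From mathcomp Require Import vcharacter.

Set Implicit Arguments.
Unset Strict Implicit.
Unset Printing Implicit Defensive.

Import GroupScope.

Lemma maximal_cases (gT : finGroupType) (G M H : {group gT}) :
  maximal M G -> M \subset H -> H \subset G -> H :=: M \/ H :=: G.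
Proof.
move=> maxM; have /maximal_eqP[_] : maximal_eq M G by rewrite /maximal_eq maxM orbT.
by move=> cases sMH sHG; case: (cases H sMH sHG) => ->; [left | right].
Qed.

(** As [M] is maximal and not normal, ['N_G(M)] is [M]. A join smaller than [G] would be [M] itself,
    so [g] would normalise [M] and lie in it. *)
Lemma joing_maximal_conj (gT : finGroupType) (G M : {group gT}) (g : gT) :
  maximal M G -> ~~ (M <| G) -> g \in G -> g \notin M -> M <*> M :^ g = G.
Proof.
move=> maxM nnM Gg M'g; have sMG := proper_sub (maxgroupp maxM).
have sMgG: M :^ g \subset G by rewrite -(conjGid Gg) conjSg.
have sMMgG: M <*> M :^ g \subset G by rewrite join_subG sMG.
have [MMg|<- //] := maximal_cases maxM (joing_subl M (M :^ g)) sMMgG.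
have Ng: g \in 'N_G(M).
  by rewrite inE Gg inE -{2}MMg joing_subr.
have sMN: M \subset 'N_G(M) by rewrite subsetI sMG normG.
have [NM|NG] := maximal_cases maxM sMN (subsetIl G 'N(M)).
  by rewrite -NM Ng in M'g.
by case/negP: nnM; rewrite /normal sMG -{1}NG subsetIr.
Qed.

(** If ['N_G(P)] were proper for a Sylow subgroup [P], it would lie in a maximal [M], normal by
    hypothesis, and the Frattini argument would give [G = M * 'N_G(P) = M]. So every Sylow subgroup
    is normal and lies in ['F(G)]. *)
Lemma nilpotent_maximal_normal (gT : finGroupType) (G : {group gT}) :
  (forall M : {group gT}, maximal M G -> M <| G) -> nilpotent G.
Proof.
move=> maxN; suff sGF: G \subset 'F(G) by apply: nilpotentS sGF (Fitting_nil G).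
rewrite -{1}[gval G]Sylow_gen gen_subG; apply/bigcupsP=> P /SylowP[p _ sylP].
apply: Fitting_max; last exact: pgroup_nil (pHall_pgroup sylP).
rewrite /normal (pHall_sub sylP) -{1}(setIidPl (subxx G)).
have [/= NG|[M maxM sNM]] := maximal_exists (subsetIl G 'N(P)).
  by rewrite setIid -{1}NG subsetIr.
have sPM: P \subset M.
  by apply: subset_trans sNM; rewrite subsetI (pHall_sub sylP) normG.
have [_ ltMG] := andP (maxgroupp maxM); case/negP: ltMG.
have sMG := normal_sub (maxN M maxM).
rewrite -(Frattini_arg (maxN M maxM) (pHall_subl sPM sMG sylP)).
by rewrite mulG_subG subxx.
Qed.

(** A chief factor [U / V] meets the centre of the nilpotent group [G / V]. A central element
    generates a normal cyclic subgroup, which by minimality is the whole factor. *)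
Lemma nilpotent_supersolvable (gT : finGroupType) (G : {group gT}) :
  nilpotent G -> supersolvable G.
Proof.
move=> nilG; have [s chs lasts] := chief_series_exists (normal_refl G).
exists s => //; apply: sub_path chs => V U /= chUV.
have /andP[/maxgroupp /andP[/proper_sub sVU nVG] nUG] := chUV.
have sUG := normal_sub nUG.
rewrite /normal_cyclic_factor sVU nUG /normal (subset_trans sVU sUG) nVG /=.
have [/andP[ntUV nUVG] minUV] := mingroupP (chief_factor_minnormal chUV).
have nUVGV: U / V <| G / V by rewrite quotient_normal.
have := meet_center_nil (quotient_nil V nilG) nUVGV ntUV.
case/trivgPn=> x /setIP[Ux /centerP[Gx cGx]] ntx.
rewrite -(minUV <[x]>%G) ?cycle_cyclic ?cycle_subG //=.
rewrite cycle_eq1 ntx cents_norm // centsC cycle_subG.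
by apply/centP=> y /cGx.
Qed.

Lemma noncyclic_three_cyclic (gT : finGroupType) (K : {group gT}) :
  ~~ cyclic K ->
  exists s : seq {group gT}, [/\ uniq s, size s = 3
    & {in s, forall H : {group gT}, H :!=: 1 /\ H \proper K}].
Proof.
move=> ncK; have [x Kx maxx] := arg_maxnP order (group1 K).
have pr z : z \in K -> <[z]> \proper K.
  move=> Kz; rewrite properEneq cycle_subG Kz andbT.
  by apply: contraNneq ncK => <-; apply: cycle_cyclic.
have /subsetPn[y Ky x'y]: ~~ (K \subset <[x]>).
  by rewrite proper_subn ?pr.
have x'xy: x * y \notin <[x]> by rewrite groupMl ?cycle_id.
have y'x: x \notin <[y]>.
  apply: contra x'y => yx.
  suff ->: <[x]> = <[y]> by apply: cycle_id.
  by apply/eqP; rewrite eqEcard cycle_subG yx; apply: maxx.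
have nt z : z \notin <[x]> -> <[z]> != 1.
  by apply: contraNneq => /eqP; rewrite cycle_eq1 => /eqP->; apply: group1.
exists [:: <[x]>%G; <[y]>%G; <[x * y]>%G]; split=> //.
  rewrite /= !inE !negb_or andbT -andbA; apply/and3P; split.
  - by apply: contraNneq x'y => /(congr1 val) /= ->; apply: cycle_id.
  - by apply: contraNneq x'xy => /(congr1 val) /= ->; apply: cycle_id.
  apply: contraNneq y'x => /(congr1 val) /= yxy.
  by rewrite -(groupMr x (cycle_id y)) /= yxy cycle_id.
have ntx: <[x]> != 1.
  by rewrite cycle_eq1; apply: contraNneq y'x => ->; apply: group1.
by move=> H; rewrite !inE => /or3P[] /eqP->; split;
  by [apply: ntx | apply: nt | apply: pr; rewrite ?groupM].
Qed.

(* Being inside L, no two members of s generate G, so any three of them form a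
   claw with centre M. *)
Lemma clawfree_neighbours_le2 (gT : finGroupType) (G M L : {group gT})
    (s : seq {group gT}) :
    clawfree (@diff_graph gT G) -> maximal M G -> M :!=: 1 ->
    L \proper G -> uniq s ->
    {in s, forall H : {group gT},
       [/\ H \subset L, ~~ (H \subset M) & M * H != G]} ->
  size s <= 2.
Proof.
move=> clawfreeG maxM ntM prL Us Ps; rewrite leqNgt; apply/negP=> s_gt2.
case/maxgroupP: (maxM) => prM maxM'.
have vM: nontrivial_proper_subgroup G M by apply/andP.
have vs H : H \in s -> nontrivial_proper_subgroup G H.
  case/Ps=> sHL nHM _; rewrite /nontrivial_proper_subgroup (sub_proper_trans sHL) //.
  by rewrite andbT; apply: contraNneq nHM => ->; apply: sub1G.
pose m : diff_vertex G := Sub M vM.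
pose H (i : 'I_3) := nth 1%G s i.
have sH i : H i \in s by rewrite mem_nth // (leq_trans _ s_gt2).
pose phi (w : 'I_1 + 'I_3) : diff_vertex G :=
  if w is inr i then Sub (H i) (vs _ (sH i)) else m.
have nMH i : M <> H i by case: (Ps _ (sH i)) => _ + _ E; rewrite -E subxx.
have adjMH i : diff_graph (phi (inl ord0)) (phi (inr i)).
  case: (Ps _ (sH i)) => _ nHM nMHG; apply/and3P; split=> //.
    by rewrite -val_eqE; apply/eqP; apply: nMH.
  rewrite eqEproper; apply/andP; split.
    by have /andP[_ /proper_sub] := vs _ (sH i); rewrite join_subG (proper_sub prM).
  apply: contra nHM => /maxM'/(_ (joing_subl _ _)) <-; exact: joing_subr.
apply: clawfreeG; exists phi; split=> [[i|i] [j|j] /(congr1 val) /= E | [i|i] [j|j]].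
- by rewrite (ord1 i) (ord1 j).
- by case: (nMH j).
- by case: (nMH i).
- congr inr; apply/val_inj/eqP; rewrite -(nth_uniq 1%G _ _ Us); first exact/eqP.
    exact: leq_trans (ltn_ord i) s_gt2.
  exact: leq_trans (ltn_ord j) s_gt2.
- exact: diff_graph_irreflexive.
- exact: adjMH.
- by rewrite diff_graph_symmetric; apply: adjMH.
apply/negbTE; rewrite negb_and; apply/orP; right.
rewrite negb_and; apply/orP; left; rewrite proper_neq //=.
apply: sub_proper_trans prL; rewrite join_subG.
by have [-> _ _] := Ps _ (sH i); have [-> _ _] := Ps _ (sH j).
Qed.

Lemma clawfree_maximal_cyclic (gT : finGroupType) (G M : {group gT}) :
  clawfree (@diff_graph gT G) -> maximal M G -> ~~ (M <| G) -> cyclic M.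
Proof.
move=> clawfreeG maxM nnM; have [sMG ltMG] := andP (maxgroupp maxM).
have ntM: M :!=: 1 by apply: contraNneq nnM => ->; apply: normal1.
have [g Gg M'g] := subsetPn ltMG.
have MMgG := joing_maximal_conj maxM nnM Gg M'g.
(* If [g = a * b ^ g] with [a] and [b] in [M], cancelling [g] on the right gives [a * g^-1 * b = 1],
   so [g] is in [M]. *)
have nMMg: M * M :^ g != G.
  apply: contra M'g => /eqP defG; move: Gg; rewrite -defG.
  case/mulsgP=> a _ Ma /imsetP[b Mb ->] defg.
  have {defg} agb1: a * g^-1 * b = 1.
    by apply: (mulIg g); rewrite mul1g [RHS]defg conjgE !mulgA.
  rewrite -groupV -(groupMl _ Ma) -(groupMr _ Mb) agb1; exact: group1.
have prMg: M :^ g \proper G.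
  by rewrite -(conjGid Gg) properJ; apply: maxgroupp maxM.
have few s :=
  clawfree_neighbours_le2 (L := (M :^ g)%G) (s := s) clawfreeG maxM ntM prMg.
have nMgM: ~~ (M :^ g \subset M).
  by apply: contra ltMG; rewrite -MMgG join_subG subxx.
have [x Nx M'x] := subsetPn nMgM.
rewrite -(cyclicJ M g); apply: contraT => ncN.
have neN z: (M :^ g)%G != <[z]>%G.
  apply/eqP=> /(congr1 val) /= defN; case/negP: ncN.
  by rewrite defN cycle_cyclic.
(* The noncyclic [M :^ g] is already one neighbour of [M], which leaves room for only one cyclic
   subgroup generated by an element outside [M]. *)
have eqx y: y \in M :^ g -> y \notin M -> <[x]>%G = <[y]>%G.
  move=> Ny M'y; apply/eqP/idPn=> nexy.
  suff: 3 <= 2 by [].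
  apply: (few [:: (M :^ g)%G; <[x]>%G; <[y]>%G]).
    by rewrite /= !inE !negb_or !neN nexy.
  have nMz z: z \in M :^ g -> M * <[z]> != G.
    rewrite -cycle_subG => sNz; apply: contraNneq nMMg => defG.
    rewrite eqEsubset mulG_subG sMG (proper_sub prMg) -{1}defG /=.
    exact: mulgS.
  by move=> H; rewrite !inE => /or3P[] /eqP->; split; rewrite /= ?cycle_subG ?nMz.
case/negP: ncN; apply/cyclicP; exists x; apply/eqP.
rewrite eqEsubset cycle_subG Nx andbT; apply/subsetP=> y Ny.
have [My|M'y] := boolP (y \in M); last first.
  by have /(congr1 val) /= -> := eqx y Ny M'y; apply: cycle_id.
(* For [y] in [M], the product [x * y] is still outside [M], so it lies in [<[x]>], and hence so
   does [y]. *)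
have M'xy: x * y \notin M by rewrite groupMr.
rewrite -(groupMl y (cycle_id x)).
by have /(congr1 val) /= -> := eqx _ (groupM Nx Ny) M'xy; apply: cycle_id.
Qed.

Lemma clawfree_nonnormal_maximal_supersolvable (gT : finGroupType)
    (G M : {group gT}) :
  clawfree (@diff_graph gT G) -> maximal M G -> ~~ (M <| G) -> supersolvable G.
Proof.
move=> clawfreeG maxM nnM.
have cycM := clawfree_maximal_cyclic clawfreeG maxM nnM.
have abM := cyclic_abelian cycM.
have [sMG ltMG] := andP (maxgroupp maxM).
have ntM: M :!=: 1 by apply: contraNneq nnM => ->; apply: normal1.
pose Z := 'Z(G)%G.
have nZG : Z <| G := center_normal G.
(* Otherwise [M] and [Z] generate [G], and both normalise [M]. *)
have sZM : Z \subset M.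
  have sMZG: M <*> Z \subset G by rewrite join_subG sMG center_sub.
  have [MZ|ZG] := maximal_cases maxM (joing_subl M Z) sMZG.
    by rewrite -MZ joing_subr.
  case/negP: nnM; rewrite /normal sMG -{1}ZG join_subG normG.
  by rewrite cents_norm // subIset // centS ?orbT.
have nZM : Z <| M := normalS sZM sMG nZG.
have ltMZ : M / Z \proper G / Z by rewrite quotient_proper ?(maxgroupp maxM).
have ntMZ : M / Z != 1.
  rewrite quotient_neq1 // properEneq sZM andbT.
  by apply: contraNneq nnM => <-.
have frob : [Frobenius G / Z with complement M / Z].
  rewrite /Frobenius_group_with_complement proper_neq //=.
  apply/normedTI_memJ_P; rewrite setD_eq0 subG1 (proper_sub ltMZ).
  split=> // u _ /setD1P[nta /morphimP[a nZa Ma def_u]] /morphimP[g nZg Gg ->].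
  rewrite {u}def_u in nta *.
  have modM h: h \in G -> (coset Z h \in M / Z) = (h \in M).
    move=> Gh; have nZh := subsetP (normal_norm nZG) h Gh.
    by rewrite -cycle_subG -quotient_cycle // quotientSGK ?cycle_subG.
  have Ga := subsetP sMG a Ma.
  rewrite -morphJ // !inE morphJ // conjg_eq1 nta -morphJ // !modM ?(groupJ Ga Gg) //.
  apply/idP/idP=> [Mag|Mg]; last exact: groupJ.
  (* [M] and [M :^ g] are abelian and both contain [a ^ g], so their join [G] centralises [a ^ g];
     thus [a ^ g], and with it [a], lies in [Z]. *)
  apply: contraR nta => M'g; apply/eqP/coset_id.
  rewrite -(memJ_norm _ nZg) inE groupJ //=.
  rewrite -sub_cent1 -(joing_maximal_conj maxM nnM Gg M'g) join_subG sub_cent1.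
  rewrite (subsetP abM) // sub_cent1 centJ memJ_conjg.
  exact: subsetP abM a Ma.
have [K frobK] := Frobenius_kernel_exists frob.
have [/sdprod_context[nKG _ defG _ tiKM] _ _ prK _] := Frobenius_context frobK.
have prL: coset Z @*^-1 K \proper G by rewrite -(quotientGK nZG) cosetpre_proper.
have nLG: coset Z @*^-1 K <| G by rewrite -(quotientGK nZG) cosetpre_normal.
have cycK : cyclic K.
  apply: contraT => /noncyclic_three_cyclic[s [Us s3 Ps]].
  pose t := [seq (coset Z @*^-1 gval H)%G | H <- s].
  have := @clawfree_neighbours_le2 _ G M (coset Z @*^-1 K)%G t clawfreeG maxM.
  rewrite size_map s3 => /(_ ntM prL) size_t.
  suff: 3 <= 2 by [].
  apply: size_t.
    rewrite map_inj_uniq // => A B /(congr1 (fun H : {group gT} => H / Z)) /=.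
    by rewrite !cosetpreK => /val_inj.
  move=> _ /mapP[H /Ps[ntH prH] ->]; split=> /=.
  - by rewrite morphpreS ?proper_sub.
  - apply: contra ntH => /(quotientS Z); rewrite cosetpreK => sHM.
    by rewrite -subG1 -tiKM subsetI proper_sub.
  (* If the product were [G], then modulo [Z] Dedekind's law would give [K = (K :&: M / Z) * H = H],
     although [H] is proper in [K]. *)
  apply/eqP=> /(congr1 (fun A => A / Z)).
  rewrite quotientMl ?normal_norm // cosetpreK => defMH.
  case/andP: prH => sHK /negP[].
  have <-: K :&: (M / Z * H) = K by rewrite defMH; apply/setIidPl/normal_sub.
  by rewrite -group_modr // tiKM mul1g.
exists [:: Z; (coset Z @*^-1 K)%G; G] => //=; rewrite andbT; apply/and3P; split.
- rewrite /normal_cyclic_factor sub1G normal1 nZG quotient_cyclic //.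
  exact: cyclicS cycM.
- rewrite /normal_cyclic_factor sub_cosetpre nZG cosetpreK cycK andbT.
  by rewrite nLG.
(* The top factor is isomorphic to [(G / Z) / K], an image of the cyclic complement [M / Z]. *)
rewrite /normal_cyclic_factor proper_sub // normal_refl nLG /=.
rewrite -(isog_cyclic (third_isog (sub_cosetpre K) nZG nLG)) /= cosetpreK -defG.
by rewrite quotientMidl !quotient_cyclic.
Qed.

Theorem theorem4p1 (gT : finGroupType) (G : {group gT})
  (clawfree_DG : clawfree (@diff_graph gT G)) : supersolvable G.
Proof.
have [/existsP[M /andP[maxM nnM]]|] :=
    boolP [exists M : {group gT}, maximal M G && ~~ (M <| G)].
  exact: clawfree_nonnormal_maximal_supersolvable clawfree_DG maxM nnM.
rewrite negb_exists => /forallP maxN.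
apply/nilpotent_supersolvable/nilpotent_maximal_normal=> M maxM.
by have := maxN M; rewrite maxM negbK.
Qed.
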